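(* For any integer $k\ge 2$, $\chi(K^2(2k+1,k))\le \frac{8}{3}k+\frac{20}{3}$.
   Context: For integers $m\ge 2k$, the Kneser graph $K(m,k)$ is the graph whose vertices are the $k$-element subsets of a fixed $m$-element set, two vertices $A,B$ being adjacent if and only if $A\cap B=\emptyset$. The square $G^2$ of a simple graph $G$ has vertex set $V(G)$, and two distinct vertices are adjacent in $G^2$ if and only if their distance in $G$ is at most $2$. $K^2(m,k)$ denotes the square of $K(m,k)$, and $\chi$ denotes the chromatic number. *)

(* Defs.v *)
From HB Require Import structures.
From mathcomp Require Import all_boot all_order all_algebra.

Set Implicit Arguments.
Unset Strict Implicit.
Unset Printing Implicit Defensive.

Record sgraph := SGraph {
  vertex :> finType;
  adj : rel vertex;
  adj_sym : symmetric adj;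
  adj_irrefl : irreflexive adj }.

Arguments adj {s}.

Section Distance.
Variable G : sgraph.

Definition walk (l : nat) (x y : G) : bool :=
  [exists p : l.-tuple G, path adj x p && (last x p == y)].

(* [None] stands for infinite distance. A shortest walk repeats no vertex, so
   it is enough to look at lengths below the number of vertices; see
   [distanceP]. *)
Definition distance (x y : G) : option nat :=
  ohead [seq l <- iota 0 #|G| | walk l x y].

Lemma walkP l (x y : G) :
  reflect (exists p, [/\ path adj x p, last x p = y & size p = l]) (walk l x y).
Proof.
apply: (iffP existsP) => [[p /andP[xp /eqP py]] | [p [xp py sp]]].
  by exists p; rewrite size_tuple.
by exists (Tuple (introT eqP sp)); rewrite /= xp py eqxx.
Qed.

Lemma walk_sym l (x y : G) : walk l x y = walk l y x.
Proof.
suff sub x' y' : walk l x' y' -> walk l y' x' by apply/idP/idP; apply: sub.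
case/walkP=> p [xp <- <-]; apply/walkP; exists (rev (belast x' p)); split.
- by rewrite rev_path; apply: sub_path xp => u v; rewrite /= adj_sym.
- by case: p {xp} => //= a p; rewrite rev_cons last_rcons.
- by rewrite size_rev size_belast.
Qed.

Lemma walk_short l (x y : G) :
  walk l x y -> exists2 l', walk l' x y & (l' <= l) && (l' < #|G|).
Proof.
case/walkP=> p [xp <- <-]; case/shortenP: xp => p' xp' up' sub.
exists (size p'); first by apply/walkP; exists p'.
have -> : size p' < #|G| by rewrite -[_.+1]/(size (x :: p')) -(card_uniqP up') max_card.
rewrite andbT; apply: uniq_leq_size => //; by case/andP: up'.
Qed.

Lemma distanceP (x y : G) d :
  distance x y = Some d <->
  walk d x y /\ (forall l, walk l x y -> d <= l).
Proof.
rewrite /distance; set s := [seq l <- _ | _].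
have ss : sorted ltn s by apply: sorted_filter (iota_ltn_sorted _ _); apply: ltn_trans.
have ms l : (l \in s) = walk l x y && (l < #|G|) by rewrite mem_filter mem_iota.
have min l : walk l x y -> exists2 l', l' \in s & l' <= l.
  by case/walk_short=> l' w /andP[le lt]; exists l'; rewrite // ms w.
have hd e : ohead s = Some e -> walk e x y /\ (forall l, walk l x y -> e <= l).
  move=> es; have es' : s = e :: behead s by case: (s) es => //= a t [->].
  split; first by have /andP[] : walk e x y && (e < #|G|) by rewrite -ms es' mem_head.
  move=> l /min[l' ]; rewrite es' inE => /predU1P[-> //|l't]; apply: leq_trans.
  move: ss; rewrite es' /= (path_sortedE ltn_trans) => /andP[/allP h _].
  exact/ltnW/h.
split=> [/hd //|[wd dmin]].
case E: (ohead s) => [e|]; last by case/min: wd => l; case: (s) E.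
case/hd: E => we emin; congr Some; apply/eqP.
by rewrite eqn_leq emin // dmin.
Qed.

Lemma distanceC (x y : G) : distance x y = distance y x.
Proof. by rewrite /distance (eq_filter (fun l => walk_sym l x y)). Qed.

Definition square_adj (x y : G) : bool :=
  (x != y) && (if distance x y is Some d then d <= 2 else false).

Lemma square_adj_sym : symmetric square_adj.
Proof. by move=> x y; rewrite /square_adj eq_sym distanceC. Qed.

Lemma square_adj_irrefl : irreflexive square_adj.
Proof. by move=> x; rewrite /square_adj eqxx. Qed.

Definition square : sgraph := SGraph square_adj_sym square_adj_irrefl.

End Distance.

Section Coloring.
Variable G : sgraph.

Definition colorable (n : nat) : bool :=
  [exists c : {ffun G -> 'I_n}, [forall x, forall y, adj x y ==> (c x != c y)]].

Lemma ex_colorable : exists n, colorable n.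
Proof.
exists #|G|; apply/existsP; exists [ffun x => enum_rank x].
apply/forallP=> x; apply/forallP=> y; apply/implyP; rewrite !ffunE.
by apply: contraTneq => /enum_rank_inj->; rewrite adj_irrefl.
Qed.

Definition chi : nat := ex_minn ex_colorable.

End Coloring.

Section Kneser.
Variables m k : nat.

Definition ksubset : finType := {A : {set 'I_m} | #|A| == k}.

(* The condition [A != B] only matters for k = 0, where the empty set would
   otherwise carry a loop; see [kneser_adjE]. *)
Definition kneser_adj (A B : ksubset) : bool :=
  (A != B) && (val A :&: val B == set0).

Lemma kneser_adj_sym : symmetric kneser_adj.
Proof. by move=> A B; rewrite /kneser_adj eq_sym setIC. Qed.

Lemma kneser_adj_irrefl : irreflexive kneser_adj.
Proof. by move=> A; rewrite /kneser_adj eqxx. Qed.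

Definition kneser : sgraph := SGraph kneser_adj_sym kneser_adj_irrefl.

Lemma kneser_adjE (A B : kneser) :
  0 < k -> adj A B = (val A :&: val B == set0).
Proof.
move=> k0; rewrite /= /kneser_adj; case: eqVneq => //= <-.
by rewrite setIid -cards_eq0 (eqP (valP A)) eqn0Ngt k0.
Qed.

End Kneser.

(* Main.v *)
(** Send the 2k+1 points injectively into a finite abelian group G by f and
    colour a k-set A by the sum of f over A.  Two distinct k-sets with a common
    neighbour arise by deleting one point each from the same (k+1)-set, so they
    get different colours.  If A and B are disjoint and x is the point outside
    both, then equal colours y would give 2 y = (sum of f) - f x.  This is
    impossible if, modulo 2G, the sum of f vanishes and f never does.  Take
    G = Z_2 x Z_2 x Z_m with m odd and use an odd number, at most m, of elements
    from each of the three nonzero classes modulo 2G.  This needs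
    2k+1 <= 3m, which the least odd such m satisfies with 3m <= 2k+5, and then
    |G| = 4m <= (8k+20)/3. *)
Require Import Defs.
From HB Require Import structures.
From mathcomp Require Import all_boot all_order all_algebra.
From mathcomp Require Import zify lra.

Set Implicit Arguments.
Unset Strict Implicit.
Unset Printing Implicit Defensive.

Import Order.TTheory GRing.Theory Num.Theory.
Local Open Scope ring_scope.

Lemma chi_le_card (G : sgraph) (T : finType) (c : G -> T) :
  (forall x y, adj x y -> c x != c y) -> (chi G <= #|T|)%N.
Proof.
move=> cP; rewrite /chi; case: ex_minnP => n _; apply.
apply/existsP; exists [ffun x => enum_rank (c x)].
apply/forallP=> x; apply/forallP=> y; apply/implyP=> /cP.
by rewrite !ffunE (inj_eq enum_rank_inj).
Qed.

Lemma square_adjP (G : sgraph) (x y : G) :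
  square_adj x y -> x != y /\ (adj x y \/ exists2 z, adj x z & adj z y).
Proof.
case/andP=> nxy; case E: (distance x y) => [d|//] le_d2; split=> //.
have [/walkP[p [xp py sp]] _] := (distanceP x y d).1 E.
case: p xp py sp => [|z [|t [|u p]]] /=.
- by move=> _ exy; rewrite exy eqxx in nxy.
- by case/andP=> xz _ <- _; left.
- by case/and3P=> xz zt _ <- _; right; exists z.
- by move=> _ _ sp; move: le_d2; rewrite -sp.
Qed.

Lemma setU1_of_subset_cardS (T : finType) (A C : {set T}) :
  A \subset C -> #|C| = #|A|.+1 -> exists2 a, a \notin A & C = a |: A.
Proof.
move=> sAC cardC; have /cards1P[a Da] : #|C :\: A| == 1%N.
  by rewrite cardsDS // cardC subSnn.
exists a; first by have := set11 a; rewrite -Da inE => /andP[].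
by rewrite -Da setDE setUIl [~: A :|: A]setUC setUCr setIT; apply/esym/setUidPl.
Qed.

(** The complement of B has k+1 points and contains A. *)
Lemma kneser_adj_setC (k : nat) (A B : kneser (2 * k + 1) k) :
  adj A B -> exists2 x, x \notin val A & ~: val B = x |: val A.
Proof.
move=> /andP[_ AB0]; apply: setU1_of_subset_cardS.
  by rewrite -disjoints_subset -setI_eq0.
by rewrite cardsCs setCK card_ord (eqP (valP A)) (eqP (valP B)); lia.
Qed.

Lemma chi_square_kneser_le (k : nat) (G : finZmodType)
    (f : 'I_(2 * k + 1) -> G) :
  injective f -> (forall x y, y *+ 2 != \sum_i f i - f x) ->
  (chi (square (kneser (2 * k + 1) k)) <= #|G|)%N.
Proof.
move=> f_inj f2.
pose c (A : kneser (2 * k + 1) k) := \sum_(i in val A) f i.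
apply: (@chi_le_card (square (kneser (2 * k + 1) k)) G c) => A B.
move=> /(@square_adjP (kneser (2 * k + 1) k))[nAB]; rewrite /c {c}.
case=> [/kneser_adj_setC[x xA DB] | [Z AZ]].
  apply/eqP=> eqAB; have /eqP[] := f2 x (\sum_(i in val B) f i).
  have -> : \sum_i f i =
      \sum_(i in val B) f i + (f x + \sum_(i in val A) f i).
    rewrite (bigID [in val B]) -big_setU1 //= -DB; congr (_ + _).
    by apply: eq_bigl => i; rewrite inE.
  by rewrite eqAB mulr2n addrCA [f x + _]addrC addrK.
rewrite adj_sym => BZ.
(* Both [a |: A] and [b |: B] are the complement of Z, so equal colours force [f a = f b]. *)
have [a aA Da] := kneser_adj_setC AZ; have [b bB Db] := kneser_adj_setC BZ.
apply: contra_neq nAB => eqAB.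
have eq_sum : f a + \sum_(i in val A) f i = f b + \sum_(i in val B) f i.
  by rewrite -!big_setU1 //= -Da -Db.
move: eq_sum; rewrite eqAB => /addIr/f_inj eab; subst b.
by apply: val_inj; rewrite -(setU1K aA) -(setU1K bB) -Da -Db.
Qed.

HB.instance Definition _ (G H : finZmodType) := GRing.Zmodule.on (G * H)%type.

(** For m odd this is the quotient of the colour group by its doubles. *)
Definition klein : finZmodType := ('I_2 * 'I_2)%type.

Lemma klein_mulr2n (v : klein) : v *+ 2 = 0.
Proof. by case: v => [[[|[|i]] ? ] [[|[|j]] ?]] //; apply/eqP. Qed.

Definition klein_class (n1 n2 : nat) (i : nat) : klein :=
  if (i < n1)%N then (1, 0) else if (i < n1 + n2)%N then (0, 1) else (1, 1).

Lemma sum_klein_class (n1 n2 n3 : nat) :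
  odd n1 -> odd n2 -> odd n3 ->
  \sum_(i < n1 + n2 + n3) klein_class n1 n2 i = 0.
Proof.
move=> o1 o2 o3.
(* Blocks of odd size thus contribute (1, 0), (0, 1) and (1, 1), which cancel. *)
have const (v : klein) n : odd n -> v *+ n = v.
  move=> on; rewrite -(odd_double_half n) on mulrnDr -mul2n mulrnA.
  by rewrite klein_mulr2n mul0rn addr0.
rewrite !big_split_ord /=.
rewrite (eq_bigr (fun=> (1, 0) : klein)) => [|i _]; last first.
  by rewrite /klein_class ltn_ord.
rewrite [X in _ + X + _](eq_bigr (fun=> (0, 1) : klein)) => [|i _]; last first.
  by rewrite /klein_class ltn_add2l ltn_ord ltnNge leq_addr.
rewrite [X in _ + _ + X](eq_bigr (fun=> (1, 1) : klein)) => [|i _]; last first.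
  by rewrite /klein_class !ltnNge leq_addr -addnA leq_addr.
by rewrite !sumr_const !card_ord !const //; apply/eqP.
Qed.

(** Used for injectivity: each class is an interval of at most m indices, which residues mod m
    separate. *)
Lemma eq_mod_close (m i j : nat) :
  (i < j + m)%N -> (j < i + m)%N -> i = j %[mod m] -> i = j.
Proof.
wlog le_ij : i j / (i <= j)%N => [H ij ji eq_ij|_ lt_ji].
  by case/orP: (leq_total i j) => /H; [|move=> H'; apply/esym]; auto.
move/esym/eqP; rewrite eqn_mod_dvd // => /dvdn_leq; lia.
Qed.

(** The classes have sizes 2a+1, 2b+1 and 2c+1, with sum 2k+1; the largest size serves as m. *)
Lemma chi_square_kneser_le_odd (k a b c : nat) :
  (b <= a)%N -> (c <= a)%N -> (a + b + c).+1 = k ->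
  (chi (square (kneser (2 * k + 1) k)) <= 4 * a.*2.+1)%N.
Proof.
move=> ba ca Dk.
pose cls := klein_class a.*2.+1 b.*2.+1.
have cls_neq0 i : cls i != 0.
  by rewrite /cls /klein_class; do 2?case: ifP.
pose f (i : 'I_(2 * k + 1)) : klein * 'I_a.*2.+1 := (cls i, inZp i).
have <- : #|{: klein * 'I_a.*2.+1}| = (4 * a.*2.+1)%N.
  by rewrite !card_prod !card_ord.
apply: (@chi_square_kneser_le k _ f) => [i j [] | x y].
  rewrite /cls /klein_class => eq_cls eq_mod; apply: val_inj => /=.
  apply: eq_mod_close eq_mod; have := ltn_ord i; have := ltn_ord j;
    move: eq_cls; do 4?case: ifP => //; lia.
have mod2 (v : klein * 'I_a.*2.+1) : (v *+ 2).1 = 0.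
  by rewrite raddfMn klein_mulr2n.
have sum_cls : (\sum_i f i).1 = 0.
  rewrite raddf_sum /=.
  rewrite -[RHS](@sum_klein_class a.*2.+1 b.*2.+1 c.*2.+1) ?oddS ?odd_double //.
  have -> : (2 * k + 1 = a.*2.+1 + b.*2.+1 + c.*2.+1)%N by lia.
  by [].
apply/eqP=> /(congr1 fst); rewrite mod2 raddfB /= sum_cls sub0r => /esym/eqP.
by rewrite oppr_eq0 (negPf (cls_neq0 x)).
Qed.

Theorem corollary2p7 (k : nat) (hk : (2 <= k)%N) :
  (chi (square (kneser (2 * k + 1)%N k)))%:R <= 8 / 3 * k%:R + 20 / 3 :> rat.
Proof.
(* Splitting k-1 as evenly as possible makes the largest part [k.+1 %/ 3], hence 3m <= 2k+5. *)
have [b_le c_le Dk] : [/\ k %/ 3 <= k.+1 %/ 3, k.-1 %/ 3 <= k.+1 %/ 3 &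
    (k.+1 %/ 3 + k %/ 3 + k.-1 %/ 3).+1 = k]%N by split; lia.
have chi_le := chi_square_kneser_le_odd b_le c_le Dk.
have : (3 * chi (square (kneser (2 * k + 1) k)) <= 8 * k + 20)%N by lia.
rewrite -(ler_nat rat) natrD !natrM; lra.
Qed.
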